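(* Let $(H,\mu,u,\Delta,\varepsilon,S)$ be a Hopf algebra over a field $\Bbbk$ with basis $\{h_i\mid i\in I\}$, and write $\Delta(h_i)=\sum_{j,k}a^i_{j,k}\,h_j\otimes h_k$ with only finitely many non-zero coefficients $a^i_{j,k}\in\Bbbk$ for each $i$. Let $(M,\partial_M)$ be an algebraic partial $H$-comodule with basis $\{m_\ell\mid\ell\in L\}$, and write $\partial_M(m_\ell)=\sum_{p,i}b^\ell_{p,i}\,m_p\otimes h_i$ with only finitely many non-zero coefficients $b^\ell_{p,i}\in\Bbbk$ for each $\ell$. Let $Q\subset M\otimes H$ be the subspace generated by the elements $$\sum_{q,p,k}b^\ell_{p,t}\,b^p_{q,k}\,m_q\otimes h_k-\sum_{q,p,k}b^\ell_{q,p}\,a^p_{k,t}\,m_q\otimes h_k,\qquad \ell\in L,\ t\in I.$$ Put $M\bullet H=(M\otimes H)/Q$, let $\pi_M:M\otimes H\to M\bullet H$ be the canonical projection and $\rho_M=\pi_M\circ\partial_M$. Then $(M,M\bullet H,\pi_M,\rho_M)$ is a geometric partial $H$-comodule (in $\mathsf{Vect}_\Bbbk$).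
   Context: An algebraic partial (right) $H$-comodule is a $\Bbbk$-vector space $M$ with a linear map $\partial_M:M\to M\otimes H$ satisfying: (1) $(M\otimes\varepsilon)\circ\partial_M=\mathrm{Id}_M$; (2) $(M\otimes H\otimes\mu)(M\otimes H\otimes S\otimes H)(M\otimes\Delta\otimes H)(\partial_M\otimes H)\partial_M=(M\otimes H\otimes\mu)(M\otimes H\otimes S\otimes H)(\partial_M\otimes H\otimes H)(\partial_M\otimes H)\partial_M$; (3) $(M\otimes\mu\otimes H)(M\otimes S\otimes H\otimes H)(M\otimes H\otimes\Delta)(\partial_M\otimes H)\partial_M=(M\otimes\mu\otimes H)(M\otimes S\otimes H\otimes H)(\partial_M\otimes H\otimes H)(\partial_M\otimes H)\partial_M$. A geometric partial $H$-comodule in $\mathsf{Vect}_\Bbbk$ is $(X,X\bullet H,\pi_X,\rho_X)$ with $\rho_X:X\to X\bullet H$ linear and $\pi_X:X\otimes H\to X\bullet H$ a linear surjection satisfying the following. Let $(X\bullet H)\bullet H$, with maps $\rho_X\bullet H:X\bullet H\to (X\bullet H)\bullet H$ and $\pi_{X\bullet H}:(X\bullet H)\otimes H\to (X\bullet H)\bullet H$, be the pushout of $\pi_X$ and $\rho_X\otimes H$; let $X\bullet(H\bullet H)$, with maps $X\bullet\Delta:X\bullet H\to X\bullet(H\bullet H)$ and $\pi_{X,\Delta}:(X\bullet H)\otimes H\to X\bullet(H\bullet H)$, be the pushout of $\pi_X$ and $(\pi_X\otimes H)\circ(X\otimes\Delta)$. Then: (GPC1) there is $X\bullet\varepsilon:X\bullet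 H\to X$ with $(X\bullet\varepsilon)\circ\rho_X=\mathrm{Id}_X$ and $(X\bullet\varepsilon)\circ\pi_X=X\otimes\varepsilon$; (GPC2) there is an isomorphism $\theta:X\bullet(H\bullet H)\to(X\bullet H)\bullet H$ with $\theta\circ\pi_{X,\Delta}=\pi_{X\bullet H}$ and $\theta\circ(X\bullet\Delta)\circ\rho_X=(\rho_X\bullet H)\circ\rho_X$. *)

(* Defs.v *)
From HB Require Import structures.
From mathcomp Require Import all_boot all_algebra generic_quotient ring_quotient.
From mathcomp Require Import boolp classical_sets functions cardinality fsbigop.
From mathcomp.multinomials Require Import freeg.

Set Implicit Arguments.
Unset Strict Implicit.
Unset Printing Implicit Defensive.

Import GRing.Theory.
Local Open Scope ring_scope.
Local Open Scope classical_set_scope.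
Local Open Scope quotient_scope.

(** * Linear spans, quotients and bases *)

Section Span.
Variables (R : nzRingType) (V : lmodType R).

Definition lspan (A : set V) : {pred V} :=
  [pred v | `[< exists2 s : seq (R * V),
     (forall x, x \in s -> A x.2) & v = \sum_(x <- s) x.1 *: x.2 >]].

Lemma lspanP (A : set V) (v : V) :
  reflect (exists2 s : seq (R * V),
     (forall x, x \in s -> A x.2) & v = \sum_(x <- s) x.1 *: x.2)
   (v \in lspan A).
Proof. exact: asboolP. Qed.

Lemma mem_lspan (A : set V) (v : V) : A v -> v \in lspan A.
Proof.
move=> Av; apply/lspanP; exists [:: (1, v)]; last by rewrite big_seq1 scale1r.
by move=> x; rewrite inE => /eqP ->.
Qed.

Lemma lspan_submod_closed (A : set V) : submod_closed (lspan A).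
Proof.
split; first by apply/lspanP; exists [::]; rewrite ?big_nil.
move=> c u v /lspanP[s sA ->] /lspanP[t tA ->]; apply/lspanP.
exists ([seq (c * x.1, x.2) | x <- s] ++ t).
  by move=> x; rewrite mem_cat => /orP[/mapP[y ys ->]|/tA//]; exact: (sA y).
rewrite big_cat big_map scaler_sumr /=; congr (_ + _).
by apply: eq_bigr => x _; rewrite scalerA.
Qed.

HB.instance Definition _ (A : set V) :=
  GRing.isSubmodClosed.Build R V (lspan A) (lspan_submod_closed A).

End Span.

Section QuotientModule.
Variables (R : nzRingType) (V : lmodType R) (A : set V).

(* The quotient V / <A> of V by the submodule spanned by A; the library only
   provides its additive group structure. *)
Definition lquot := Quotient.quot (lspan A).
HB.instance Definition _ := Quotient.on lquot.
HB.instance Definition _ := GRing.Zmodule.on lquot.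

Definition lpi : V -> lquot := \pi_lquot.

Lemma lpi_eq (x y : V) : (lpi x == lpi y) = (x - y \in lspan A).
Proof. by rewrite Quotient.idealrBE. Qed.

Lemma lpi_surj (q : lquot) : exists x, lpi x = q.
Proof. by exists (repr q); exact: reprK. Qed.

Lemma lpiD : {morph lpi : x y / x + y}.
Proof. exact: (raddfD \pi_(Quotient.quot (lspan A))). Qed.

Definition lquot_scale (c : R) (q : lquot) : lquot := lpi (c *: repr q).

Lemma lpiZ (c : R) (x : V) : lpi (c *: x) = lquot_scale c (lpi x).
Proof.
apply/eqP; rewrite lpi_eq -scalerBr rpredZ // -lpi_eq.
by apply/eqP; rewrite /lpi reprK.
Qed.

Lemma lquot_scalerA a b q :
  lquot_scale a (lquot_scale b q) = lquot_scale (a * b) q.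
Proof. by case: (lpi_surj q) => x <-; rewrite -!lpiZ scalerA. Qed.

Lemma lquot_scale1r : left_id 1 lquot_scale.
Proof. by move=> q; case: (lpi_surj q) => x <-; rewrite -lpiZ scale1r. Qed.

Lemma lquot_scalerDr : right_distributive lquot_scale +%R.
Proof.
move=> c p q; case: (lpi_surj p) (lpi_surj q) => x <- [y <-].
by rewrite -!lpiZ -!lpiD -lpiZ scalerDr.
Qed.

Lemma lquot_scalerDl q : {morph lquot_scale^~ q : a b / a + b}.
Proof.
by move=> a b; case: (lpi_surj q) => x <-; rewrite -!lpiZ -lpiD scalerDl.
Qed.

HB.instance Definition _ := GRing.Zmodule_isLmodule.Build R lquot
  lquot_scalerA lquot_scale1r lquot_scalerDr lquot_scalerDl.

Lemma lpi_is_linear : linear lpi.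
Proof. by move=> c x y; rewrite lpiD lpiZ. Qed.

HB.instance Definition _ :=
  GRing.isLinear.Build R V lquot _ lpi lpi_is_linear.

Lemma lquot_factor (W : lmodType R) (f : {linear V -> W}) :
  (forall x, A x -> f x = 0) ->
  exists g : {linear lquot -> W}, forall x, g (lpi x) = f x.
Proof.
move=> fA; pose g (q : lquot) := f (repr q).
have gE x : g (lpi x) = f x.
  have : repr (lpi x) - x \in lspan A by rewrite -lpi_eq; apply/eqP/reprK.
  case/lspanP => s sA e; apply/eqP; rewrite -subr_eq0 -linearB e linear_sum.
  rewrite big_seq big1 // => y /sA /fA fy.
  by rewrite linearZ /= fy scaler0.
have g_linear : linear g.
  move=> c p q; case: (lpi_surj p) (lpi_surj q) => x <- [y <-].
  by rewrite -linearP !gE linearP.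
pose G : {linear lquot -> W} :=
  HB.pack g (GRing.isLinear.Build _ _ _ _ g g_linear).
by exists G.
Qed.

End QuotientModule.

Definition is_basis (R : nzRingType) (V : lmodType R) (I : choiceType)
    (e : I -> V) : Prop :=
  (forall (s : seq I) (c : I -> R), uniq s ->
     \sum_(i <- s) c i *: e i = 0 -> forall i, i \in s -> c i = 0) /\
  (forall v, v \in lspan (range e)).

(** * Tensor products *)

Section Tensor.
Variables (k : fieldType) (U V : lmodType k).
Local Notation free := {freeg (U * V)%type / k}.
Local Notation gen u v := (<< (u, v) >> : free).

Definition tensor_rel : set free := [set z |
  [\/ exists u u' v, z = gen (u + u') v - (gen u v + gen u' v),
      exists u v v', z = gen u (v + v') - (gen u v + gen u v'),
      exists (c : k) u v, z = gen (c *: u) v - c *: gen u v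
    | exists (c : k) u v, z = gen u (c *: v) - c *: gen u v]].

Definition tensor := lquot tensor_rel.
HB.instance Definition _ := GRing.Lmodule.on tensor.

Definition tmul (u : U) (v : V) : tensor := lpi tensor_rel (gen u v).

Lemma tmul_bilinear : bilinear_for *:%R *:%R tmul.
Proof.
have rel z x y : z = x - y -> tensor_rel z ->
    lpi tensor_rel x = lpi tensor_rel y.
  by move=> -> ?; apply/eqP; rewrite lpi_eq; exact: mem_lspan.
split=> [v c u u'|u c v v']; rewrite /= /tmul -linearP.
- transitivity (lpi tensor_rel (gen (c *: u) v + gen u' v)).
    by apply: rel (erefl _) _; apply: Or41; exists (c *: u), u', v.
  rewrite !linearD; congr (_ + _).
  by apply: rel (erefl _) _; apply: Or43; exists c, u, v.
- transitivity (lpi tensor_rel (gen u (c *: v) + gen u v')).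
    by apply: rel (erefl _) _; apply: Or42; exists u, (c *: v), v'.
  rewrite !linearD; congr (_ + _).
  by apply: rel (erefl _) _; apply: Or44; exists c, u, v.
Qed.

End Tensor.

Notation "U ⊗ V" := (tensor U V) (at level 40, left associativity).
Notation "u \ox v" := (tmul u v) (at level 40, left associativity).

Section TensorLift.
Variables (k : fieldType) (U V W : lmodType k) (f : U -> V -> W).

(* Linear, with value f u v at u \ox v, when f is bilinear. *)
Definition tlift (t : U ⊗ V) : W := fglift (fun x => f x.1 x.2) (repr t).

Hypothesis f_bilin : bilinear_for *:%R *:%R f.

Let lift (z : {freeg (U * V)%type / k}) : W := fglift (fun x => f x.1 x.2) z.

Let liftD : {morph lift : x y / x + y}.
Proof.
have liftB : {morph lift : x y / x - y} by exact: lift_is_additive.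
have lift0 : lift 0 = 0 by rewrite -[0 in LHS](subrr 0) liftB subrr.
by move=> x y; rewrite -{1}[y]opprK liftB -[- y]sub0r liftB lift0 sub0r opprK.
Qed.

Let liftZ c : {morph lift : x / c *: x}.
Proof.
move=> x; rewrite -(freeg_sumE x) scaler_sumr.
have lift0 : lift 0 = 0 by apply: (addrI (lift 0)); rewrite -liftD !addr0.
rewrite !(big_morph lift liftD lift0) scaler_sumr; apply: eq_bigr => i _.
have -> (a : k) : c *: (<< a *g i >> : {freeg (U * V)%type / k}) = << c * a *g i >>.
  by apply/eqP/freeg_eqP => j; rewrite coeffZ !coeffU mulrA.
by rewrite /lift !liftU scalerA.
Qed.

Let lift_linear : linear lift.
Proof. by move=> c x y; rewrite liftD liftZ. Qed.

Let liftF : {linear {freeg (U * V)%type / k} -> W} :=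
  HB.pack lift (GRing.isLinear.Build _ _ _ _ lift lift_linear).

Let lift_rel z : z \in lspan (@tensor_rel k U V) -> lift z = 0.
Proof.
have lift1 u v : lift << (u, v) >> = f u v by rewrite /lift liftU scale1r.
have [fl fr] := f_bilin.
have flD u u' v : f (u + u') v = f u v + f u' v.
  by have /= := fl v 1 u u'; rewrite !scale1r.
have frD u v v' : f u (v + v') = f u v + f u v'.
  by have /= := fr u 1 v v'; rewrite !scale1r.
have fl0 v : f 0 v = 0 by apply: (addrI (f 0 v)); rewrite -flD !addr0.
have fr0 u : f u 0 = 0 by apply: (addrI (f u 0)); rewrite -frD !addr0.
case/lspanP => s sA ->; rewrite -[lift]/(liftF : _ -> _) linear_sum big_seq.
apply: big1 => x /sA xA; rewrite linearZ; apply/eqP; rewrite scaler_eq0.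
apply/orP; right; apply/eqP; case: xA.
- by move=> [u [u' [v ->]]]; rewrite linearB linearD /= !lift1 flD subrr.
- by move=> [u [v [v' ->]]]; rewrite linearB linearD /= !lift1 frD subrr.
- move=> [c [u [v ->]]]; rewrite linearB linearZ /= !lift1.
  by have /= := fl v c u 0; rewrite addr0 fl0 addr0 => ->; rewrite subrr.
- move=> [c [u [v ->]]]; rewrite linearB linearZ /= !lift1.
  by have /= := fr u c v 0; rewrite addr0 fr0 addr0 => ->; rewrite subrr.
Qed.

Let tliftE z : tlift (lpi _ z) = lift z.
Proof.
apply/eqP; rewrite -subr_eq0 /tlift -/(lift _) -[lift]/(liftF : _ -> _).
rewrite -linearB; apply/eqP/lift_rel; rewrite -lpi_eq; apply/eqP.
exact: reprK.
Qed.

Lemma tlift_tmul u v : tlift (u \ox v) = f u v.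
Proof. by rewrite tliftE /lift liftU scale1r. Qed.

Lemma tlift_linear : linear tlift.
Proof.
move=> c x y; case: (lpi_surj x) (lpi_surj y) => a <- [b <-].
by rewrite -linearP !tliftE lift_linear.
Qed.

End TensorLift.

Section TmulTheory.
Variables (k : fieldType).
Implicit Types U V W : lmodType k.

Lemma tmulDl U V (v : V) : {morph (fun u : U => u \ox v) : x y / x + y}.
Proof.
by move=> x y; have /= := (@tmul_bilinear k U V).1 v 1 x y; rewrite !scale1r.
Qed.

Lemma tmulDr U V (u : U) : {morph (fun v : V => u \ox v) : x y / x + y}.
Proof.
by move=> x y; have /= := (@tmul_bilinear k U V).2 u 1 x y; rewrite !scale1r.
Qed.

Lemma tmul0l U V (v : V) : (0 : U) \ox v = 0.
Proof. by apply: (addrI ((0 : U) \ox v)); rewrite -tmulDl !addr0. Qed.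

Lemma tmul0r U V (u : U) : u \ox (0 : V) = 0.
Proof. by apply: (addrI (u \ox (0 : V))); rewrite -tmulDr !addr0. Qed.

Lemma tmulZl U V c (u : U) (v : V) : (c *: u) \ox v = c *: (u \ox v).
Proof. by have /= := (@tmul_bilinear k U V).1 v c u 0; rewrite addr0 tmul0l addr0. Qed.

Lemma tmulZr U V c (u : U) (v : V) : u \ox (c *: v) = c *: (u \ox v).
Proof. by have /= := (@tmul_bilinear k U V).2 u c v 0; rewrite addr0 tmul0r addr0. Qed.

End TmulTheory.

Section TensorTheory.
Variables (k : fieldType) (U V : lmodType k).

Lemma tensor_span (t : U ⊗ V) :
  exists s : seq (U * V), t = \sum_(x <- s) x.1 \ox x.2.
Proof.
case: (lpi_surj t) => z <-; rewrite -(freeg_sumE z) linear_sum /=.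
exists [seq (coeff x z *: x.1, x.2) | x <- dom z]; rewrite [RHS]big_map.
apply: eq_bigr => -[u v] _ /=.
rewrite tmulZl /tmul -linearZ /=; congr (lpi _ _).
by apply/eqP/freeg_eqP => j; rewrite coeffZ !coeffU mulrA mulr1.
Qed.

Lemma tensor_ext (W : lmodType k) (f g : {linear U ⊗ V -> W}) :
  (forall u v, f (u \ox v) = g (u \ox v)) -> f =1 g.
Proof.
move=> fg t; case: (tensor_span t) => s ->; rewrite !linear_sum.
by apply: eq_bigr => x _.
Qed.

End TensorTheory.

Section TensorMap.
Variables (k : fieldType) (U U' V V' : lmodType k).
Variables (f : {linear U -> U'}) (g : {linear V -> V'}).

Definition tmap : U ⊗ V -> U' ⊗ V' := tlift (fun u v => f u \ox g v).

Lemma tmap_bilinear : bilinear_for *:%R *:%R (fun u v => f u \ox g v).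
Proof.
by split=> [v c x y|u c x y]; rewrite linearP ?(tmulDl, tmulDr) ?(tmulZl, tmulZr).
Qed.

Lemma tmapE u v : tmap (u \ox v) = f u \ox g v.
Proof. exact: tlift_tmul tmap_bilinear _ _. Qed.

HB.instance Definition _ := GRing.isLinear.Build k (U ⊗ V) (U' ⊗ V') _ tmap
  (tlift_linear tmap_bilinear).

End TensorMap.

Section TensorIso.
Variable k : fieldType.

Lemma tlift_bilinearl (U V W X : lmodType k) (f : U -> V -> W -> X) :
  (forall w, bilinear_for *:%R *:%R (fun u v => f u v w)) ->
  (forall u v, linear (f u v)) ->
  bilinear_for *:%R *:%R (fun t w => tlift (fun u v => f u v w) t).
Proof.
move=> fUV fW; split=> [w|t c x y]; first exact: tlift_linear.
case: (tensor_span t) => s ->.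
have E w : tlift (fun u v => f u v w) (\sum_(x <- s) x.1 \ox x.2) =
    \sum_(x <- s) f x.1 x.2 w.
  pose F : {linear U ⊗ V -> X} := HB.pack (tlift (fun u v => f u v w))
    (GRing.isLinear.Build _ _ _ _ _ (tlift_linear (fUV w))).
  rewrite -[LHS]/(F _) linear_sum; apply: eq_bigr => z _.
  exact: tlift_tmul (fUV w) _ _.
rewrite /= !E scaler_sumr -big_split; apply: eq_bigr => z _.
exact: fW.
Qed.

Lemma tlift_bilinearr (U V W X : lmodType k) (f : U -> V -> W -> X) :
  (forall u, bilinear_for *:%R *:%R (f u)) ->
  (forall v w, linear (fun u => f u v w)) ->
  bilinear_for *:%R *:%R (fun u t => tlift (f u) t).
Proof.
move=> fVW fU.
have [lin1 lin2] := @tlift_bilinearl V W U X (fun v w u => f u v w) fVW fU.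
by split=> [t|u]; [exact: lin2|exact: lin1].
Qed.

Section Assoc.
Variables U V W : lmodType k.

Definition tassoc : (U ⊗ V) ⊗ W -> U ⊗ (V ⊗ W) :=
  tlift (fun t w => tlift (fun u v => u \ox (v \ox w)) t).

Definition tassocV : U ⊗ (V ⊗ W) -> (U ⊗ V) ⊗ W :=
  tlift (fun u t => tlift (fun v w => (u \ox v) \ox w) t).

Let tassoc_bilinear : bilinear_for *:%R *:%R
  (fun t w => tlift (fun (u : U) (v : V) => u \ox (v \ox w)) t : U ⊗ (V ⊗ W)).
Proof.
apply: tlift_bilinearl => [w|u v c x y].
  by split=> [v c x y|u c x y]; rewrite ?(tmulDl, tmulZl, tmulDr, tmulZr).
by rewrite !(tmulDr, tmulZr).
Qed.

Let tassocV_bilinear : bilinear_for *:%R *:%R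
  (fun u t => tlift (fun (v : V) (w : W) => (u \ox v) \ox w) t : (U ⊗ V) ⊗ W).
Proof.
apply: tlift_bilinearr => [u|v w c x y].
  by split=> [w c x y|v c x y]; rewrite ?(tmulDr, tmulZr, tmulDl, tmulZl).
by rewrite !(tmulDl, tmulZl).
Qed.

HB.instance Definition _ := GRing.isLinear.Build k ((U ⊗ V) ⊗ W) (U ⊗ (V ⊗ W)) _
  tassoc (tlift_linear tassoc_bilinear).
HB.instance Definition _ := GRing.isLinear.Build k (U ⊗ (V ⊗ W)) ((U ⊗ V) ⊗ W) _
  tassocV (tlift_linear tassocV_bilinear).

Lemma tassocE u v w : tassoc ((u \ox v) \ox w) = u \ox (v \ox w).
Proof.
rewrite /tassoc tlift_tmul // tlift_tmul //.
by split=> [y c x z|y c x z]; rewrite ?(tmulDl, tmulZl, tmulDr, tmulZr).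
Qed.

Lemma tassocVE u v w : tassocV (u \ox (v \ox w)) = (u \ox v) \ox w.
Proof.
rewrite /tassocV tlift_tmul // tlift_tmul //.
by split=> [y c x z|y c x z]; rewrite ?(tmulDr, tmulZr, tmulDl, tmulZl).
Qed.

End Assoc.

Section Unit.
Variable U : lmodType k.

(* The canonical isomorphisms U ⊗ k ≅ U and k ⊗ U ≅ U. *)
Definition tunitr : U ⊗ k^o -> U := tlift (fun (u : U) (c : k^o) => (c : k) *: u).
Definition tunitl : k^o ⊗ U -> U := tlift (fun (c : k^o) (u : U) => (c : k) *: u).

Let tunitr_bilinear :
  bilinear_for *:%R *:%R (fun (u : U) (c : k^o) => (c : k) *: u).
Proof.
split=> [c a x y|u a x y] /=; first by rewrite scalerDr !scalerA mulrC.
by rewrite scalerDl scalerA.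
Qed.

Let tunitl_bilinear :
  bilinear_for *:%R *:%R (fun (c : k^o) (u : U) => (c : k) *: u).
Proof. by split; [exact: tunitr_bilinear.2|exact: tunitr_bilinear.1]. Qed.

HB.instance Definition _ := GRing.isLinear.Build k (U ⊗ k^o) U _
  tunitr (tlift_linear tunitr_bilinear).
HB.instance Definition _ := GRing.isLinear.Build k (k^o ⊗ U) U _
  tunitl (tlift_linear tunitl_bilinear).

Lemma tunitrE u (c : k^o) : tunitr (u \ox c) = c *: u.
Proof. exact: tlift_tmul tunitr_bilinear _ _. Qed.

Lemma tunitlE (c : k^o) u : tunitl (c \ox u) = c *: u.
Proof. exact: tlift_tmul tunitl_bilinear _ _. Qed.

End Unit.
End TensorIso.

(** * Hopf algebras *)

Section TensorAlgebra.
Variables (k : fieldType) (A : algType k).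

Definition talg_mu : A ⊗ A -> A := tlift (fun x y => x * y).

Let talg_mu_bilinear : bilinear_for *:%R *:%R (fun x y : A => x * y).
Proof.
split=> [z c x y|z c x y] /=; first by rewrite mulrDl scalerAl.
by rewrite mulrDr scalerAr.
Qed.

HB.instance Definition _ := GRing.isLinear.Build k (A ⊗ A) A _
  talg_mu (tlift_linear talg_mu_bilinear).

Lemma talg_muE x y : talg_mu (x \ox y) = x * y.
Proof. exact: tlift_tmul talg_mu_bilinear _ _. Qed.

(* The product of the algebra A ⊗ A. *)
Definition tensor_mul (x y : A ⊗ A) : A ⊗ A :=
  tlift (fun a b => tlift (fun c d => (a * c) \ox (b * d)) y) x.

Lemma tensor_mulE a b c d :
  tensor_mul (a \ox b) (c \ox d) = (a * c) \ox (b * d).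
Proof.
have bil1 a' b' : bilinear_for *:%R *:%R
    (fun c' d' : A => (a' * c') \ox (b' * d')).
  split=> [z e x y|z e x y] /=.
    by rewrite mulrDr tmulDl -scalerAr tmulZl.
  by rewrite mulrDr tmulDr -scalerAr tmulZr.
have bil2 c' d' : bilinear_for *:%R *:%R
    (fun a' b' : A => (a' * c') \ox (b' * d')).
  split=> [z e x y|z e x y] /=.
    by rewrite mulrDl tmulDl -scalerAl tmulZl.
  by rewrite mulrDl tmulDr -scalerAl tmulZr.
rewrite /tensor_mul tlift_tmul ?tlift_tmul //.
split=> [b' | a'].
- have [lin _] := @tlift_bilinearr k A A A (A ⊗ A)
    (fun a' c' d' => (a' * c') \ox (b' * d')) (bil1^~ b')
    (fun c' d' => (bil2 c' d').1 b').
  exact: lin.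
- have [lin _] := @tlift_bilinearr k A A A (A ⊗ A)
    (fun b' c' d' => (a' * c') \ox (b' * d')) (bil1 a')
    (fun c' d' => (bil2 c' d').2 a').
  exact: lin.
Qed.

End TensorAlgebra.

Arguments talg_mu {k} A.
Notation "\id_ U" := (idfun : {linear U -> U}) (at level 8, U at level 2).

Section Comodules.
Variables (k : fieldType) (H : algType k).
Variables (Delta : {linear H -> H ⊗ H}) (eps : {linear H -> k^o}).
Variable (S : {linear H -> H}).

(* The multiplication and the unit are those of the k-algebra H. *)
Record is_hopf_algebra : Prop := IsHopfAlgebra {
  comul_coassoc : forall x,
    tassoc (tmap Delta \id_H (Delta x)) = tmap \id_H Delta (Delta x);
  comul_counitl : forall x, tunitl (tmap eps \id_H (Delta x)) = x;
  comul_counitr : forall x, tunitr (tmap \id_H eps (Delta x)) = x;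
  comul1 : Delta 1 = 1 \ox 1;
  comulM : forall x y, Delta (x * y) = tensor_mul (Delta x) (Delta y);
  counit1 : eps 1 = 1;
  counitM : forall x y, eps (x * y) = (eps x : k) * eps y;
  antipodel : forall x, talg_mu H (tmap S \id_H (Delta x)) = eps x *: 1;
  antipoder : forall x, talg_mu H (tmap \id_H S (Delta x)) = eps x *: 1
}.

(* Iterated tensor products are bracketed to the left. *)
Definition tensor_comul (U : lmodType k) : {linear U ⊗ H -> (U ⊗ H) ⊗ H} :=
  @tassocV k U H H \o tmap \id_U Delta.

Definition tensor_mu (U : lmodType k) : {linear (U ⊗ H) ⊗ H -> U ⊗ H} :=
  tmap \id_U (talg_mu H) \o @tassoc k U H H.

Definition tensor_counit (U : lmodType k) : {linear U ⊗ H -> U} :=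
  @tunitr k U \o tmap \id_U eps.

(* (U ⊗ H ⊗ mu) (U ⊗ H ⊗ S ⊗ H) *)
Definition antipode_mur (U : lmodType k) :
    {linear ((U ⊗ H) ⊗ H) ⊗ H -> (U ⊗ H) ⊗ H} :=
  tensor_mu (U ⊗ H) \o tmap (tmap \id_(U ⊗ H) S) \id_H.

(* (U ⊗ mu ⊗ H) (U ⊗ S ⊗ H ⊗ H) *)
Definition antipode_mul (U : lmodType k) :
    {linear ((U ⊗ H) ⊗ H) ⊗ H -> (U ⊗ H) ⊗ H} :=
  tmap (tensor_mu U) \id_H \o tmap (tmap (tmap \id_U S) \id_H) \id_H.

Record is_algebraic_partial_comodule (M : lmodType k)
    (dM : {linear M -> M ⊗ H}) : Prop := IsAlgebraicPartialComodule {
  apc_counit : forall m, tensor_counit M (dM m) = m;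
  apc_coassocr : forall m,
    antipode_mur M (tmap (tensor_comul M) \id_H (tmap dM \id_H (dM m))) =
    antipode_mur M (tmap (tmap dM \id_H) \id_H (tmap dM \id_H (dM m)));
  apc_coassocl : forall m,
    antipode_mul M (tensor_comul (M ⊗ H) (tmap dM \id_H (dM m))) =
    antipode_mul M (tmap (tmap dM \id_H) \id_H (tmap dM \id_H (dM m)))
}.

End Comodules.

(** * Pushouts and geometric partial comodules *)

Section Pushout.
Variables (k : fieldType) (U A B : lmodType k).
Variables (f : {linear U -> A}) (g : {linear U -> B}).

Definition pushout_rel : set (A * B)%type := range (fun u => (f u, - g u)).

Definition pushout := lquot pushout_rel.
HB.instance Definition _ := GRing.Lmodule.on pushout.

Definition pushout_inl (a : A) : pushout := lpi pushout_rel (a, 0).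
Definition pushout_inr (b : B) : pushout := lpi pushout_rel (0, b).

Let pushout_inl_linear : linear pushout_inl.
Proof.
move=> c x y; rewrite /pushout_inl -linearP; congr (lpi _ _).
by congr (_, _); rewrite /= scaler0 addr0.
Qed.

Let pushout_inr_linear : linear pushout_inr.
Proof.
move=> c x y; rewrite /pushout_inr -linearP; congr (lpi _ _).
by congr (_, _); rewrite /= scaler0 addr0.
Qed.

HB.instance Definition _ :=
  GRing.isLinear.Build k A pushout _ pushout_inl pushout_inl_linear.
HB.instance Definition _ :=
  GRing.isLinear.Build k B pushout _ pushout_inr pushout_inr_linear.

Lemma pushout_comm u : pushout_inl (f u) = pushout_inr (g u).
Proof.
apply/eqP; rewrite lpi_eq; apply: mem_lspan; exists u => //.
by congr (_, _); rewrite /= ?subr0 ?sub0r.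
Qed.

Lemma pushout_universal (W : lmodType k) (p : {linear A -> W})
    (q : {linear B -> W}) : (forall u, p (f u) = q (g u)) ->
  exists r : {linear pushout -> W},
    [/\ forall a, r (pushout_inl a) = p a, forall b, r (pushout_inr b) = q b
      & forall r' : {linear pushout -> W},
          (forall a, r' (pushout_inl a) = p a) ->
          (forall b, r' (pushout_inr b) = q b) -> r' =1 r].
Proof.
move=> pq; pose pq_fun (x : (A * B)%type) : W := p x.1 + q x.2.
have pq_linear : linear pq_fun.
  by move=> c x y; rewrite /pq_fun !linearP scalerDr addrACA.
pose F : {linear (A * B)%type -> W} := HB.pack pq_fun
  (GRing.isLinear.Build _ _ _ _ pq_fun pq_linear).
have [|r rE] := @lquot_factor k _ pushout_rel W F.
  by move=> _ [u _ <-]; rewrite /= /pq_fun /= linearN pq subrr.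
exists r; split=> [a|b|r' r'l r'r x].
- by rewrite rE /= /pq_fun /= linear0 addr0.
- by rewrite rE /= /pq_fun /= linear0 add0r.
case: (lpi_surj x) => -[a b] <-; rewrite rE /= /pq_fun /= -r'l -r'r -linearD.
rewrite /pushout_inl /pushout_inr -linearD; congr (r' (lpi _ _)).
by congr (_, _); rewrite /= ?addr0 ?add0r.
Qed.

End Pushout.

Section Geometric.
Variables (k : fieldType) (H : algType k).
Variables (Delta : {linear H -> H ⊗ H}) (eps : {linear H -> k^o}).
Variables (X XH : lmodType k).
Variables (piX : {linear X ⊗ H -> XH}) (rhoX : {linear X -> XH}).

Let rhoX_H : {linear X ⊗ H -> XH ⊗ H} := tmap rhoX \id_H.
Let piX_Delta : {linear X ⊗ H -> XH ⊗ H} :=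
  tmap piX \id_H \o tensor_comul Delta X.

(* pushout piX rhoX_H is (X • H) • H, with rho • H and pi_(X • H) its left and
   right injections; pushout piX piX_Delta is X • (H • H), with X • Delta and
   pi_(X, Delta) its left and right injections. *)
Record is_geometric_partial_comodule : Prop := IsGeometricPartialComodule {
  gpc_surj : forall y, exists x, piX x = y;
  gpc_counit : exists Xeps : {linear XH -> X},
    (forall x, Xeps (rhoX x) = x) /\
    (forall z, Xeps (piX z) = tensor_counit eps X z);
  gpc_coassoc :
    exists theta : {linear pushout piX piX_Delta -> pushout piX rhoX_H},
    [/\ bijective theta,
        forall z, theta (pushout_inr piX piX_Delta z) =
                  pushout_inr piX rhoX_H z
      & forall x, theta (pushout_inl piX piX_Delta (rhoX x)) =
                  pushout_inl piX rhoX_H (rhoX x)]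
}.

End Geometric.

(* Main.v *)
Require Import Defs.
From HB Require Import structures.
From mathcomp Require Import all_boot all_algebra.
From mathcomp Require Import boolp classical_sets functions cardinality fsbigop.

Set Implicit Arguments.
Unset Strict Implicit.
Unset Printing Implicit Defensive.

Import GRing.Theory.
Local Open Scope ring_scope.
Local Open Scope classical_set_scope.

(** Write [rho] for the coaction and
      [D x = (rho (x) H) (rho x) - (M (x) Delta) (rho x)]
    for its failure to be coassociative; it takes values in [(M (x) H) (x) H].
    Expanding in the two bases shows that the generator of [Q] with index [(l, t)]
    is the slice [(M (x) H (x) h_t^* ) (D m_l)], where [h_t^*] is the coordinate
    functional of [h_t].  Hence [Q] is the smallest subspace with [D x] in
    [Q (x) H] for every [x], and, [pi] being the projection modulo [Q],
    [(pi (x) H) (D x) = 0].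

    Counit.  Counitality of [rho] and of [Delta] gives
    [(M (x) eps (x) H) (D x) = rho x - rho x = 0].  Applying [h_t^*] to the last
    factor, [M (x) eps] kills [Q], so it descends to the quotient.

    Coassociativity.  The two pushouts are taken along the same projection [pi];
    they differ only in their second legs [g1 = (pi (x) H) (M (x) Delta)] and
    [g2 = (pi rho) (x) H].  If [g1] and [g2] agree on [Q], each pushout satisfies
    the universal property of the other ([pushout_quotient_map_iso]), and the
    remaining compatibility is [g1 (rho x) = g2 (rho x)], that is
    [(pi (x) H) (D x) = 0].  That they agree on [Q] follows, slice by slice, from
    [(g1 (x) H) (D x) = (g2 (x) H) (D x)] ([legs_agree_on_defect]):
    coassociativity of [Delta] gives
      [(M (x) Delta (x) H) (D x) - (rho (x) H (x) H) (D x)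
         = (M (x) H (x) Delta) (D x) - (D (x) H) (rho x)],
    and [pi (x) H (x) H] kills both terms on the right, because [pi (x) H] kills
    [D]. *)

(** * Spans and coordinates *)

Lemma lspan_ind (R : nzRingType) (V : lmodType R) (A : set V) (P : V -> Prop) :
  P 0 -> (forall c x v, A x -> P v -> P (c *: x + v)) ->
  forall v, v \in lspan A -> P v.
Proof.
move=> P0 PD v /lspanP[s + ->]; elim: s => [|x s IHs] sA; first by rewrite big_nil.
rewrite big_cons; apply: PD; first by apply: sA; rewrite mem_head.
by apply: IHs => y ys; apply: sA; rewrite inE ys orbT.
Qed.

(** Spanning families may repeat elements; collecting equal indices puts a vector
    in the form to which linear independence applies. *)
Lemma lspan_image_uniq (R : nzRingType) (V : lmodType R) (I : choiceType)
    (e : I -> V) (A : set I) (v : V) :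
  v \in lspan (e @` A) -> exists (s : seq I) (c : I -> R),
    [/\ uniq s, forall i, i \in s -> A i & v = \sum_(i <- s) c i *: e i].
Proof.
elim/lspan_ind => {v} [|c _ v [i Ai <-] [s [d [us sA ->]]]].
  by exists [::], (fun=> 0); split=> //; rewrite big_nil.
have [si|si] := boolP (i \in s).
  exists s, (fun j => (if j == i then c else 0) + d j); split=> //.
  under [RHS]eq_bigr do rewrite scalerDl.
  rewrite big_split /=; congr (_ + _); rewrite (bigD1_seq i) //= eqxx.
  by rewrite big1 ?addr0 // => j /negPf ->; rewrite scale0r.
exists (i :: s), (fun j => if j == i then c else d j); split.
- by rewrite /= si us.
- by move=> j; rewrite inE => /predU1P[->|/sA].
rewrite big_cons eqxx; congr (_ + _); apply: eq_big_seq => j sj.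
by case: eqP => // ji; rewrite -ji sj in si.
Qed.

Lemma eq_on_span (R : nzRingType) (V W : lmodType R) (A : set V)
    (f g : {linear V -> W}) :
  (forall v, v \in lspan A) -> (forall x, A x -> f x = g x) -> f =1 g.
Proof.
move=> A_span fg v; elim/lspan_ind: {v}(A_span v) => [|c x v Ax IHv].
  by rewrite !linear0.
by rewrite !linearP fg // IHv.
Qed.

(** The coordinate of [v] along [e i] is the unique [c] such that [v - c *: e i]
    lies in the span of the other basis vectors; uniqueness makes it linear
    without having to choose an expansion of [v]. *)
Lemma basis_dual (k : fieldType) (V : lmodType k) (I : choiceType) (e : I -> V) :
  is_basis e -> exists f : I -> {linear V -> k^o},
    forall i j, f i (e j) = (i == j)%:R.
Proof.
move=> [e_free e_span].
suff /choice[f fP] : forall i, exists g : {linear V -> k^o},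
  forall j, g (e j) = (i == j)%:R by exists f.
move=> i.
pose W := lspan (e @` [set j | j != i]).
have We j : j != i -> e j \in W by move=> ji; apply: mem_lspan; exists j.
have ceW c : c *: e i \in W -> c = 0.
  move=> /lspan_image_uniq[s [d [us sA /esym/eqP]]].
  rewrite -subr_eq0 addrC => /eqP ce0.
  have si : i \notin s by apply/negP => /sA /=; rewrite eqxx.
  apply/eqP; rewrite -oppr_eq0; apply/eqP.
  rewrite -(@e_free (i :: s) (fun j => if j == i then - c else d j) _ _ i).
  - by rewrite eqxx.
  - by rewrite /= si us.
  - rewrite big_cons eqxx scaleNr -[RHS]ce0; congr (_ + _).
    by apply: eq_big_seq => j sj; case: eqP => // ji; rewrite -ji sj in si.
  - exact: mem_head.
have [f fP] : exists f : V -> k, forall v, v - f v *: e i \in W.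
  suff /choice[f fP] : forall v, exists c, v - c *: e i \in W by exists f.
  move=> v; elim/lspan_ind: {v}(e_span v) => [|c _ v [j _ <-] [d Wd]].
    by exists 0; rewrite scale0r subr0 rpred0.
  have [->|ji] := eqVneq j i.
    by exists (c + d); rewrite scalerDl opprD addrACA subrr add0r.
  by exists d; rewrite -addrA rpredD // rpredZ // We.
have fE v c : v - c *: e i \in W -> f v = c.
  move=> Wc; apply/eqP; rewrite -subr_eq0; apply/eqP/ceW.
  rewrite scalerBl.
  have -> : f v *: e i - c *: e i = (v - c *: e i) - (v - f v *: e i).
    by rewrite opprB [RHS]addrC addrA subrK.
  by rewrite rpredB.
have f_linear : linear (f : V -> k^o).
  move=> c u v; apply: fE.
  have -> : c *: u + v - (c * f u + f v) *: e i =
      c *: (u - f u *: e i) + (v - f v *: e i).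
    by rewrite scalerDl scalerBr scalerA opprD addrACA.
  by rewrite rpredD // rpredZ.
pose F : {linear V -> k^o} := HB.pack (f : V -> k^o)
  (GRing.isLinear.Build _ _ _ _ (f : V -> k^o) f_linear).
exists F => j; apply: fE; have [->|ij] := eqVneq i j.
  by rewrite scale1r subrr rpred0.
by rewrite scale0r subr0 We // eq_sym.
Qed.

(** Every sufficiently large index list works, not just one, so that expansions of
    several vectors can later be brought to a common list. *)
Lemma basis_coord_sum (k : fieldType) (V : lmodType k) (I : choiceType)
    (e : I -> V) (f : I -> {linear V -> k^o}) :
  is_basis e -> (forall i j, f i (e j) = (i == j)%:R) ->
  forall v, exists s0 : seq I, forall s, uniq s -> {subset s0 <= s} ->
    v = \sum_(i <- s) (f i v : k) *: e i.
Proof.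
move=> [_ e_span] fe v.
elim/lspan_ind: {v}(e_span v) => [|c _ v [j _ <-] [s0 s0P]].
  by exists [::] => s _ _; rewrite big1 // => i _; rewrite linear0 scale0r.
exists (j :: s0) => s us sub.
under eq_bigr do rewrite linearP /= scalerDl.
rewrite big_split /= -s0P //; last first.
  by move=> i si; apply: sub; rewrite inE si orbT.
congr (_ + _); rewrite (bigD1_seq j) ?sub ?mem_head //= fe eqxx.
rewrite big1 ?addr0 => [|i ij]; first by rewrite -[_ *: true%:R]/(c * 1) mulr1.
by rewrite fe (negPf ij) scaler0 scale0r.
Qed.

(** * Maps between tensor products *)

Lemma tensor_ind (k : fieldType) (U V : lmodType k) (P : U ⊗ V -> Prop) :
  (forall u v, P (u \ox v)) -> (forall x y, P x -> P y -> P (x + y)) ->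
  forall t, P t.
Proof.
move=> Pm PD t; case: (tensor_span t) => s ->.
elim: s => [|x s IHs]; first by rewrite big_nil -(tmul0l U (0 : V)).
by rewrite big_cons; apply: PD.
Qed.

Lemma tmul_linear (k : fieldType) (U V : lmodType k) (u : U) :
  linear (@tmul k U V u).
Proof. exact: (tmul_bilinear U V).2. Qed.

HB.instance Definition _ (k : fieldType) (U V : lmodType k) (u : U) :=
  GRing.isLinear.Build k V (U ⊗ V) _ (tmul u) (tmul_linear u).

Lemma tensor3_ext (k : fieldType) (U V W X : lmodType k)
    (f g : {linear (U ⊗ V) ⊗ W -> X}) :
  (forall u v w, f ((u \ox v) \ox w) = g ((u \ox v) \ox w)) -> f =1 g.
Proof.
move=> fg; apply: tensor_ext => t w.
elim/tensor_ind: t => [u v|x y IHx IHy]; first exact: fg.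
by rewrite tmulDl !linearD IHx IHy.
Qed.

Lemma eq_tmapl (k : fieldType) (H U V : lmodType k) (f g : {linear U -> V}) :
  f =1 g -> tmap f \id_H =1 tmap g \id_H.
Proof. by move=> fg; apply: tensor_ext => u x; rewrite /= !tmapE fg. Qed.

Lemma tmap_id_comp (k : fieldType) (H U V W : lmodType k)
    (g : {linear V -> W}) (f : {linear U -> V}) (z : U ⊗ H) :
  tmap g \id_H (tmap f \id_H z) = tmap (g \o f) \id_H z.
Proof.
move: z; apply: (tensor_ext (f := tmap g \id_H \o tmap f \id_H)) => u x.
by rewrite /= !tmapE.
Qed.

Lemma tassocV_nat (k : fieldType) (U V H : lmodType k) (g : {linear U -> V})
    (u : U) (t : H ⊗ H) :
  tmap (tmap g \id_H) \id_H (tassocV (u \ox t)) = tassocV (g u \ox t).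
Proof.
move: t; apply: (tensor_ext
  (f := tmap (tmap g \id_H) \id_H \o (@tassocV k U H H \o tmul u))
  (g := @tassocV k V H H \o tmul (g u))) => x y.
by rewrite /= !tassocVE !tmapE /= tmapE.
Qed.

(** One face of the pentagon for the associators, with [u] held fixed. *)
Lemma tassocV_pentagon (k : fieldType) (U V W X : lmodType k) (u : U)
    (t : (V ⊗ W) ⊗ X) :
  tmap (@tassocV k U V W \o tmul u) \id_X t =
  tassocV (tassocV (u \ox tassoc t)).
Proof.
move: t; apply: (tensor3_ext
  (g := @tassocV k (U ⊗ V) W X \o (@tassocV k U V (W ⊗ X) \o
    (tmul u \o @tassoc k V W X)))) => v w x.
by rewrite /= tmapE tassocE /= !tassocVE.
Qed.

(** * Slices by functionals *)

(** Although [tensor_counit] is introduced for the counit, it makes sense for every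
    functional [f] on [H]: it is then the slice map [U (x) f], in particular
    a coordinate map when [f] is a dual basis vector. *)
Lemma tensor_counitE (k : fieldType) (H : algType k) (f : {linear H -> k^o})
    (U : lmodType k) (u : U) (x : H) :
  tensor_counit f U (u \ox x) = (f x : k) *: u.
Proof. by rewrite /= tmapE tunitrE. Qed.

Lemma tensor_counit_nat (k : fieldType) (H : algType k) (f : {linear H -> k^o})
    (U U' : lmodType k) (g : {linear U -> U'}) (z : U ⊗ H) :
  tensor_counit f U' (tmap g \id_H z) = g (tensor_counit f U z).
Proof.
move: z; apply: (tensor_ext (f := tensor_counit f U' \o tmap g \id_H)
                            (g := g \o tensor_counit f U)) => u x.
by rewrite /= !tmapE !tunitrE linearZ.
Qed.

(** Over a field, [U (x) H] is a direct sum of copies of [U] indexed by a basis of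
    [H], so the slices along the dual basis detect zero. *)
Lemma tensor_coord_eq0 (k : fieldType) (H : algType k) (I : choiceType)
    (h : I -> H) (f : I -> {linear H -> k^o}) (U : lmodType k) (z : U ⊗ H) :
  is_basis h -> (forall i j, f i (h j) = (i == j)%:R) ->
  (forall i, tensor_counit (f i) U z = 0) -> z = 0.
Proof.
move=> h_basis fh z0.
suff [s0 s0P] : exists s0 : seq I, forall s, uniq s -> {subset s0 <= s} ->
    z = \sum_(i <- s) tensor_counit (f i) U z \ox h i.
  rewrite (s0P (undup s0)) ?undup_uniq // => [|i]; last by rewrite mem_undup.
  by rewrite big1 // => i _; rewrite z0 tmul0l.
elim/tensor_ind: z {z0} => [u x|x y [sx sxP] [sy syP]].
  have [s0 s0P] := basis_coord_sum h_basis fh x; exists s0 => s us sub.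
  rewrite {1}(s0P s us sub) linear_sum.
  by apply: eq_bigr => i _; rewrite tensor_counitE tmulZl linearZ.
exists (sx ++ sy) => s us sub.
under eq_bigr do rewrite linearD tmulDl.
rewrite big_split; congr (_ + _); [apply: sxP | apply: syP] => // i si.
  by apply: sub; rewrite mem_cat si.
by apply: sub; rewrite mem_cat si orbT.
Qed.

Lemma tensor_counit_dual_sum (k : fieldType) (H : algType k) (I J : choiceType)
    (h : I -> H) (f : I -> {linear H -> k^o}) (U : lmodType k) (u : J -> U)
    (s : seq (J * I)) (c : J * I -> k) (t : I) :
  (forall i j, f i (h j) = (i == j)%:R) ->
  tensor_counit (f t) U (\sum_(x <- s) c x *: (u x.1 \ox h x.2)) =
  \sum_(x <- s | x.2 == t) c x *: u x.1.
Proof.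
move=> fh; rewrite linear_sum [RHS]big_mkcond; apply: eq_bigr => x _.
rewrite linearZ tensor_counitE fh eq_sym /=.
by case: eqP => _; rewrite ?scale1r // scale0r scaler0.
Qed.

(** * The comultiplication on the last tensor factor *)

Lemma tensor_comul_nat (k : fieldType) (H : algType k)
    (Delta : {linear H -> H ⊗ H}) (U V : lmodType k) (g : {linear U -> V})
    (z : U ⊗ H) :
  tmap (tmap g \id_H) \id_H (tensor_comul Delta U z) =
  tensor_comul Delta V (tmap g \id_H z).
Proof.
move: z; apply: (tensor_ext
  (f := tmap (tmap g \id_H) \id_H \o tensor_comul Delta U)
  (g := tensor_comul Delta V \o tmap g \id_H)) => u x.
by rewrite /= !tmapE; apply: tassocV_nat.
Qed.

Lemma tensor_comul_counit (k : fieldType) (H : algType k)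
    (Delta : {linear H -> H ⊗ H}) (eps : {linear H -> k^o}) :
  (forall x, tunitl (tmap eps \id_H (Delta x)) = x) ->
  forall (U : lmodType k) (z : U ⊗ H),
  tmap (tensor_counit eps U) \id_H (tensor_comul Delta U z) = z.
Proof.
move=> counitl U.
apply: (tensor_ext (f := tmap (tensor_counit eps U) \id_H \o
                         tensor_comul Delta U) (g := \id_(U ⊗ H))) => u x.
rewrite /= tmapE -[in RHS](counitl x).
move: (Delta x).
apply: (tensor_ext (f := tmap (tensor_counit eps U) \id_H \o
                         (@tassocV k U H H \o tmul u))
                   (g := tmul u \o (@tunitl k H \o tmap eps \id_H))) => y z.
by rewrite /= tassocVE !tmapE /= tmapE tunitlE tunitrE tmulZl tmulZr.
Qed.

(** At [u (x) x] both sides come from the two iterated coproducts of [x], rebracketed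
    in the same way after tensoring with [u]. *)
Lemma tensor_comul_coassoc (k : fieldType) (H : algType k)
    (Delta : {linear H -> H ⊗ H}) :
  (forall x, tassoc (tmap Delta \id_H (Delta x)) = tmap \id_H Delta (Delta x)) ->
  forall (U : lmodType k) (z : U ⊗ H),
  tmap (tensor_comul Delta U) \id_H (tensor_comul Delta U z) =
  tensor_comul Delta (U ⊗ H) (tensor_comul Delta U z).
Proof.
move=> coassoc U; apply: (tensor_ext
  (f := tmap (tensor_comul Delta U) \id_H \o tensor_comul Delta U)
  (g := tensor_comul Delta (U ⊗ H) \o tensor_comul Delta U)) => u x.
rewrite /= !tmapE.
pose G := @tassocV k (U ⊗ H) H H \o (@tassocV k U H (H ⊗ H) \o tmul u).
transitivity (G (tassoc (tmap Delta \id_H (Delta x)))); last first.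
  rewrite coassoc; move: (Delta x).
  apply: (tensor_ext (f := G \o tmap \id_H Delta)
    (g := tensor_comul Delta (U ⊗ H) \o (@tassocV k U H H \o tmul u))) => y z.
  by rewrite /= tmapE !tassocVE tmapE.
move: (Delta x).
apply: (tensor_ext (f := tmap (tensor_comul Delta U) \id_H \o
                         (@tassocV k U H H \o tmul u))
    (g := G \o (@tassoc k H H H \o tmap Delta \id_H))) => y z.
by rewrite /= tassocVE !tmapE /= tmapE -tassocV_pentagon tmapE.
Qed.

Lemma tensor_counit_comul (k : fieldType) (H : algType k)
    (Delta : {linear H -> H ⊗ H}) (f : {linear H -> k^o})
    (U : lmodType k) (u : U) (x : H) :
  tensor_counit f (U ⊗ H) (tensor_comul Delta U (u \ox x)) =
  u \ox tensor_counit f H (Delta x).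
Proof.
rewrite /= !tmapE; move: (Delta x).
apply: (tensor_ext (f := tensor_counit f (U ⊗ H) \o (@tassocV k U H H \o tmul u))
                   (g := tmul u \o tensor_counit f H)) => y z.
by rewrite /= tassocVE !tmapE !tunitrE linearZ.
Qed.

(** * Pushouts along a quotient map *)

Lemma lpi_eq0 (R : nzRingType) (V : lmodType R) (A : set V) (x : V) :
  A x -> lpi A x = 0.
Proof.
by move=> Ax; apply/eqP; rewrite -(linear0 (lpi A)) lpi_eq subr0 mem_lspan.
Qed.

(** [p] exhibits [Y] as [V / <A>].  The last clause, rather than a description of
    the kernel of [p], is what builds maps out of the pushouts along [p]. *)
Definition is_quotient_map (k : fieldType) (V Y : lmodType k) (A : set V)
    (p : {linear V -> Y}) : Prop :=
  [/\ forall y, exists x, p x = y, forall x, A x -> p x = 0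
    & forall (W : lmodType k) (f : {linear V -> W}),
        (forall x, A x -> f x = 0) ->
        exists g : {linear Y -> W}, forall x, g (p x) = f x].

Lemma lpi_quotient_map (k : fieldType) (V : lmodType k) (A : set V) :
  is_quotient_map A (lpi A).
Proof.
by split=> [|x|W f]; [exact: lpi_surj | exact: lpi_eq0 | exact: lquot_factor].
Qed.

(** On [A] the map [pushout_inr \o g1] agrees with
    [pushout_inr \o g2 = pushout_inl \o p = 0], so it descends along [p]; the
    result is the left leg of a cocone whose right leg is [pushout_inr]. *)
Lemma pushout_quotient_map_factor (k : fieldType) (V Y B : lmodType k)
    (A : set V) (p : {linear V -> Y}) (g1 g2 : {linear V -> B}) :
  is_quotient_map A p -> (forall x, A x -> g1 x = g2 x) ->
  exists theta : {linear pushout p g1 -> pushout p g2},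
    forall z, theta (pushout_inr p g1 z) = pushout_inr p g2 z.
Proof.
move=> [_ pA p_factor] g12; pose inr2 := pushout_inr p g2.
have [r rE] : exists r : {linear Y -> pushout p g2},
    forall x, r (p x) = (inr2 \o g1) x.
  apply: p_factor => x Ax; rewrite /= g12 // /inr2 -pushout_comm pA //.
  exact: linear0.
have [theta [_ thetaE _]] := pushout_universal rE.
by exists theta.
Qed.

Lemma pushout_inr_surj (k : fieldType) (V Y B : lmodType k)
    (p : {linear V -> Y}) (g : {linear V -> B}) (w : pushout p g) :
  (forall y, exists x, p x = y) -> exists z, pushout_inr p g z = w.
Proof.
move=> p_surj; case: (lpi_surj w) => -[q z] <-; case: (p_surj q) => x <-.
exists (g x + z); rewrite linearD /= -pushout_comm.
rewrite /pushout_inl /pushout_inr -linearD; congr (lpi _ _).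
by congr (_, _); rewrite /= ?addr0 ?add0r.
Qed.

(** The comparison maps in the two directions are mutually inverse because both
    fix the right injections, which are onto as [p] is. *)
Lemma pushout_quotient_map_iso (k : fieldType) (V Y B : lmodType k)
    (A : set V) (p : {linear V -> Y}) (g1 g2 : {linear V -> B}) :
  is_quotient_map A p -> (forall x, A x -> g1 x = g2 x) ->
  exists theta : {linear pushout p g1 -> pushout p g2},
    [/\ bijective theta,
        forall z, theta (pushout_inr p g1 z) = pushout_inr p g2 z
      & forall x, g1 x = g2 x -> theta (pushout_inl p g1 (p x)) =
                                 pushout_inl p g2 (p x)].
Proof.
move=> pQ g12; have [p_surj _ _] := pQ.
have [theta thetaE] := pushout_quotient_map_factor pQ g12.
have [eta etaE] := pushout_quotient_map_factor pQ (fun x Ax => esym (g12 x Ax)).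
exists theta; split=> [||x g12x]; last 2 first.
- exact: thetaE.
- by rewrite !pushout_comm thetaE g12x.
exists eta => y; have [z <-] := pushout_inr_surj y p_surj.
  by rewrite thetaE etaE.
by rewrite etaE thetaE.
Qed.

(** * The coassociativity defect *)

Definition coassoc_defect (k : fieldType) (H : algType k)
    (Delta : {linear H -> H ⊗ H}) (X : lmodType k)
    (rho : {linear X -> X ⊗ H}) (x : X) : (X ⊗ H) ⊗ H :=
  tmap rho \id_H (rho x) - tensor_comul Delta X (rho x).

Lemma tmap_coassoc_defect (k : fieldType) (H : algType k)
    (Delta : {linear H -> H ⊗ H}) (X Y : lmodType k)
    (rho : {linear X -> X ⊗ H}) (g : {linear X ⊗ H -> Y}) (x : X) :
  tmap g \id_H (coassoc_defect Delta rho x) =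
  tmap (g \o rho) \id_H (rho x) -
    tmap g \id_H (tensor_comul Delta X (rho x)).
Proof. by rewrite -tmap_id_comp; apply: linearB. Qed.

(** The two halves of the defect are matched separately.  On [(rho (x) H) (rho x)]
    the hypothesis applies under [_ (x) H].  On [(X (x) Delta) (rho x)],
    coassociativity of [Delta] and naturality move the comultiplication to the
    last factor on both sides, and the hypothesis applies below it. *)
Lemma legs_agree_on_defect (k : fieldType) (H : algType k)
    (Delta : {linear H -> H ⊗ H})
    (coassoc : forall x,
       tassoc (tmap Delta \id_H (Delta x)) = tmap \id_H Delta (Delta x))
    (X Y : lmodType k) (rho : {linear X -> X ⊗ H}) (p : {linear X ⊗ H -> Y}) :
  (forall x, tmap p \id_H (tensor_comul Delta X (rho x)) =
             tmap (p \o rho) \id_H (rho x)) ->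
  forall x,
    tmap (tmap p \id_H \o tensor_comul Delta X) \id_H
      (coassoc_defect Delta rho x) =
    tmap (tmap (p \o rho) \id_H) \id_H (coassoc_defect Delta rho x).
Proof.
move=> rhoP x; rewrite !tmap_coassoc_defect; congr (_ - _).
  by apply: eq_tmapl => y; apply: rhoP.
rewrite -(tmap_id_comp (tmap p \id_H)) tensor_comul_coassoc //.
by rewrite (tensor_comul_nat Delta p) rhoP (tensor_comul_nat Delta (p \o rho)).
Qed.

(** The axioms of a geometric partial comodule in terms of the second legs of the
    pushouts: they agree on [Q], which identifies the pushouts, and at the vectors
    [rho x], which makes the identification compatible with [rho]. *)
Lemma quotient_map_geometric (k : fieldType) (H : algType k)
    (Delta : {linear H -> H ⊗ H}) (eps : {linear H -> k^o})
    (X Y : lmodType k) (rho : {linear X -> X ⊗ H}) (Q : set (X ⊗ H))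
    (p : {linear X ⊗ H -> Y}) :
  is_quotient_map Q p ->
  (forall z, Q z -> tensor_counit eps X z = 0) ->
  (forall x, tensor_counit eps X (rho x) = x) ->
  (forall z, Q z -> (tmap p \id_H \o tensor_comul Delta X) z =
                    tmap (p \o rho) \id_H z) ->
  (forall x, (tmap p \id_H \o tensor_comul Delta X) (rho x) =
             tmap (p \o rho) \id_H (rho x)) ->
  is_geometric_partial_comodule Delta eps p (p \o rho).
Proof.
move=> pQ Qeps rho_eps Qlegs rho_legs; have [p_surj _ p_factor] := pQ.
split; first exact: p_surj.
- have [Xeps XepsE] := p_factor _ _ Qeps.
  by exists Xeps; split=> // x; rewrite [LHS]XepsE rho_eps.
- have [theta [theta_bij theta_inr theta_inl]] :=
    pushout_quotient_map_iso pQ Qlegs.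
  exists theta; split; [exact: theta_bij | exact: theta_inr | move=> x].
  exact: theta_inl (rho_legs x).
Qed.

(** The hypothesis that [Q] consists of the slices of the defect is used in both
    directions: as [p] kills every slice, the defect vanishes in [Y (x) H]; and
    an identity holds on [Q] as soon as it holds for the defect, because maps
    applied to the first factor commute with slicing. *)
Lemma defect_slices_geometric (k : fieldType) (H : algType k)
    (Delta : {linear H -> H ⊗ H}) (eps : {linear H -> k^o})
    (coassoc : forall x,
       tassoc (tmap Delta \id_H (Delta x)) = tmap \id_H Delta (Delta x))
    (counitl : forall x, tunitl (tmap eps \id_H (Delta x)) = x)
    (I : choiceType) (h : I -> H) (f : I -> {linear H -> k^o})
    (h_basis : is_basis h) (f_dual : forall i j, f i (h j) = (i == j)%:R)
    (X Y : lmodType k) (rho : {linear X -> X ⊗ H})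
    (rho_eps : forall x, tensor_counit eps X (rho x) = x)
    (B : set X) (B_span : forall x, x \in lspan B)
    (Q : set (X ⊗ H)) (p : {linear X ⊗ H -> Y}) :
  is_quotient_map Q p ->
  (forall z, Q z <-> exists x t, B x /\
     z = tensor_counit (f t) (X ⊗ H) (coassoc_defect Delta rho x)) ->
  is_geometric_partial_comodule Delta eps p (p \o rho).
Proof.
move=> pQ QE; have [_ pQ0 _] := pQ.
have defect0 x : tmap p \id_H (tensor_comul Delta X (rho x)) =
    tmap (p \o rho) \id_H (rho x).
  move: x; apply: (eq_on_span (f := tmap p \id_H \o (tensor_comul Delta X \o rho))
    (g := tmap (p \o rho) \id_H \o rho) B_span) => x Bx.
  apply/esym/eqP; rewrite -subr_eq0; apply/eqP.
  apply: (tensor_coord_eq0 h_basis f_dual) => t.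
  transitivity (p (tensor_counit (f t) (X ⊗ H) (coassoc_defect Delta rho x))).
    rewrite -tensor_counit_nat; congr (tensor_counit _ _ _).
    exact/esym/tmap_coassoc_defect.
  by apply: pQ0; apply/QE; exists x, t.
apply: (quotient_map_geometric pQ) => //.
- move=> _ /QE[x [t [_ ->]]].
  rewrite -tensor_counit_nat -[RHS](linear0 (tensor_counit (f t) X)).
  congr (tensor_counit _ _ _).
  rewrite tmap_coassoc_defect tensor_comul_counit //.
  have rho_eps' : tensor_counit eps X \o rho =1 \id_X by [].
  rewrite (eq_tmapl rho_eps'); apply/eqP; rewrite subr_eq0; apply/eqP.
  exact: (tensor_ext (f := tmap \id_X \id_H) (g := \id_(X ⊗ H))
    (@tmapE _ _ _ _ _ _ _)).
- move=> _ /QE[x [t [_ ->]]].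
  rewrite -!tensor_counit_nat; congr (tensor_counit _ _ _).
  exact: (legs_agree_on_defect coassoc defect0).
Qed.

(** * Slices of the defect in coordinates *)

Lemma fsbigT_seq (V : nmodType) (T : choiceType) (s : seq T) (F : T -> V) :
  uniq s -> (forall x, F x != 0 -> x \in s) ->
  \sum_(x \in [set: T]) F x = \sum_(x <- s) F x.
Proof.
move=> us Fs; rewrite (@fsbigE _ _ _ _ _ s _ us) //; last first.
  by move=> x _ xs; apply/eqP; apply: contraNT xs => /Fs.
by apply: eq_bigl => x; rewrite in_setT.
Qed.

Lemma finite_support_seq (V : nmodType) (T : choiceType) (F : T -> V) :
  finite_set [set x | F x != 0] ->
  exists s : seq T, uniq s /\ forall x, F x != 0 -> x \in s.
Proof.
move=> /finite_seqP[s sE]; exists (undup s); rewrite undup_uniq; split=> // x Fx.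
by rewrite mem_undup; have : [set` s] x by rewrite -sE.
Qed.

(** The slice passes to the inner [dM], where it selects the terms of [dM (m l)]
    with second index [t]; expanding the coaction once more yields the triples. *)
Lemma slice_coaction_twice (k : fieldType) (H : algType k) (I L : choiceType)
    (h : I -> H) (f : I -> {linear H -> k^o})
    (f_dual : forall i j, f i (h j) = (i == j)%:R)
    (M : lmodType k) (m : L -> M) (dM : {linear M -> M ⊗ H})
    (b : L -> L -> I -> k)
    (b_finite : forall l, finite_set [set p : L * I | b l p.1 p.2 != 0])
    (dM_m : forall l, dM (m l) =
       \sum_(p \in [set: L * I]) b l p.1 p.2 *: (m p.1 \ox h p.2))
    (l : L) (t : I) :
  tensor_counit (f t) (M ⊗ H) (tmap dM \id_H (dM (m l))) =
  \sum_(x \in [set: L * L * I])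
     (let: (q, p, j) := x in (b l p t * b p q j) *: (m q \ox h j)).
Proof.
have /choice[B BP] l' : exists s : seq (L * I),
    uniq s /\ forall p, b l' p.1 p.2 != 0 -> p \in s.
  exact: (finite_support_seq (b_finite l')).
have dmE l' : dM (m l') = \sum_(p <- B l') b l' p.1 p.2 *: (m p.1 \ox h p.2).
  rewrite dM_m; have [uB bB] := BP l'; apply: fsbigT_seq => // p.
  by move=> bmh; apply: bB; apply: contraNneq bmh => ->; rewrite scale0r.
rewrite tensor_counit_nat dmE.
rewrite (tensor_counit_dual_sum _ _ (fun p => b l p.1 p.2) _ f_dual).
rewrite (@fsbigT_seq _ _
  [seq (y.1, x.1, y.2) | x <- [seq x <- B l | x.2 == t], y <- B x.1]).
- rewrite big_allpairs_dep big_filter linear_sum; apply: eq_bigr => x /eqP <-.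
  rewrite linearZ /= dmE scaler_sumr; apply: eq_bigr => y _.
  by rewrite scalerA.
- apply: allpairs_uniq_dep => [|x _|].
  + by rewrite filter_uniq //; case: (BP l).
  + by case: (BP x.1).
  (* A triple forgets the second index of [x], but the filter fixes it to [t]. *)
  move=> [x y] [x' y'] /allpairsPdep[x1 [y1 [+ _ e]]].
  case: e => ? _; subst x1; rewrite mem_filter => /andP[/eqP xt _].
  move=> /allpairsPdep[x1 [z1 [+ _ e]]].
  case: e => ? _; subst x1; rewrite mem_filter => /andP[/eqP x't _].
  move=> /= [e1 e2 e3].
  have ex : x = x'.
    by rewrite [x]surjective_pairing [x']surjective_pairing e2 xt x't.
  by move: y' e1 e3; rewrite -ex => -[? ?] /= <- <-; case: y.
- move=> [[q p] j] F0.
  have bl : b l p t != 0 by apply: contraNneq F0 => ->; rewrite mul0r scale0r.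
  have bp : b p q j != 0 by apply: contraNneq F0 => ->; rewrite mulr0 scale0r.
  apply/allpairsPdep; exists (p, t), (q, j); split=> //.
    by rewrite mem_filter eqxx; have [_] := BP l; apply.
  by have [_ /(_ (q, j))] := BP p; apply.
Qed.

(** Here the slice passes to [Delta (h p)], where it selects the coefficients
    [a p j t]. *)
Lemma slice_coaction_comul (k : fieldType) (H : algType k)
    (Delta : {linear H -> H ⊗ H}) (I L : choiceType)
    (h : I -> H) (f : I -> {linear H -> k^o})
    (f_dual : forall i j, f i (h j) = (i == j)%:R)
    (a : I -> I -> I -> k)
    (a_finite : forall i, finite_set [set p : I * I | a i p.1 p.2 != 0])
    (Delta_h : forall i, Delta (h i) =
       \sum_(p \in [set: I * I]) a i p.1 p.2 *: (h p.1 \ox h p.2))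
    (M : lmodType k) (m : L -> M) (dM : {linear M -> M ⊗ H})
    (b : L -> L -> I -> k)
    (b_finite : forall l, finite_set [set p : L * I | b l p.1 p.2 != 0])
    (dM_m : forall l, dM (m l) =
       \sum_(p \in [set: L * I]) b l p.1 p.2 *: (m p.1 \ox h p.2))
    (l : L) (t : I) :
  tensor_counit (f t) (M ⊗ H) (tensor_comul Delta M (dM (m l))) =
  \sum_(x \in [set: L * I * I])
     (let: (q, p, j) := x in (b l q p * a p j t) *: (m q \ox h j)).
Proof.
have [B [uB bB]] : exists s : seq (L * I),
    uniq s /\ forall p, b l p.1 p.2 != 0 -> p \in s.
  exact: (finite_support_seq (b_finite l)).
have /choice[A AP] i : exists s : seq (I * I),
    uniq s /\ forall p, a i p.1 p.2 != 0 -> p \in s.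
  exact: (finite_support_seq (a_finite i)).
have dmE : dM (m l) = \sum_(p <- B) b l p.1 p.2 *: (m p.1 \ox h p.2).
  rewrite dM_m; apply: fsbigT_seq => // p.
  by move=> bmh; apply: bB; apply: contraNneq bmh => ->; rewrite scale0r.
have DhE i : Delta (h i) = \sum_(p <- A i) a i p.1 p.2 *: (h p.1 \ox h p.2).
  rewrite Delta_h; have [uA aA] := AP i; apply: fsbigT_seq => // p.
  by move=> ahh; apply: aA; apply: contraNneq ahh => ->; rewrite scale0r.
rewrite dmE (@fsbigT_seq _ _
  [seq (x.1, x.2, y.1) | x <- B, y <- [seq y <- A x.2 | y.2 == t]]).
- rewrite big_allpairs_dep !linear_sum; apply: eq_bigr => x _.
  rewrite !linearZ tensor_counit_comul DhE.
  rewrite (tensor_counit_dual_sum _ _ (fun p => a x.2 p.1 p.2) _ f_dual).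
  rewrite big_filter linear_sum /= scaler_sumr; apply: eq_bigr => y /eqP <-.
  by rewrite tmulZr scalerA.
- apply: allpairs_uniq_dep => [//|x _|].
    by rewrite filter_uniq //; case: (AP x.2).
  (* A triple forgets the second index of [y], but the filter fixes it to [t]. *)
  move=> [x y] [x' y'] /allpairsPdep[x1 [y1 [_ + e]]].
  case: e => ? ?; subst x1 y1; rewrite mem_filter => /andP[/eqP yt _].
  move=> /allpairsPdep[x1 [z1 [_ + e]]].
  case: e => ? ?; subst x1 z1; rewrite mem_filter => /andP[/eqP y't _].
  case: x x' y y' yt y't => [? ?] [? ?] [? ?] [? ?] /= -> ->.
  by move=> [-> -> ->].
- move=> [[q p] j] F0.
  have bq : b l q p != 0 by apply: contraNneq F0 => ->; rewrite mul0r scale0r.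
  have ap : a p j t != 0 by apply: contraNneq F0 => ->; rewrite mulr0 scale0r.
  apply/allpairsPdep; exists (q, p), (j, t); split=> //; first exact: bB.
  by rewrite mem_filter eqxx; have [_ /(_ (j, t))] := AP p; apply.
Qed.

Theorem proposition3p20 (k : fieldType)
  (H : algType k) (Delta : {linear H -> H ⊗ H}) (eps : {linear H -> k^o})
  (S : {linear H -> H}) (H_hopf : is_hopf_algebra Delta eps S)
  (I : choiceType) (h : I -> H) (h_basis : is_basis h)
  (a : I -> I -> I -> k)
  (a_finite : forall i, finite_set [set p : I * I | a i p.1 p.2 != 0])
  (Delta_h : forall i,
     Delta (h i) = \sum_(p \in [set: I * I]) a i p.1 p.2 *: (h p.1 \ox h p.2))
  (M : lmodType k) (dM : {linear M -> M ⊗ H})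
  (M_comod : is_algebraic_partial_comodule Delta eps S dM)
  (L : choiceType) (m : L -> M) (m_basis : is_basis m)
  (b : L -> L -> I -> k)
  (b_finite : forall l, finite_set [set p : L * I | b l p.1 p.2 != 0])
  (dM_m : forall l,
     dM (m l) = \sum_(p \in [set: L * I]) b l p.1 p.2 *: (m p.1 \ox h p.2)) :
  let Q_gen (l : L) (t : I) : M ⊗ H :=
    \sum_(x \in [set: L * L * I])
       (let: (q, p, j) := x in (b l p t * b p q j) *: (m q \ox h j))
    - \sum_(x \in [set: L * I * I])
       (let: (q, p, j) := x in (b l q p * a p j t) *: (m q \ox h j)) in
  let Q : set (M ⊗ H) := [set z | exists l t, z = Q_gen l t] in
  is_geometric_partial_comodule Delta eps (lpi Q) (lpi Q \o dM).
Proof.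
move=> Q_gen Q; have [f f_dual] := basis_dual h_basis.
have [_ m_span] := m_basis.
apply: (defect_slices_geometric (comul_coassoc H_hopf) (comul_counitl H_hopf)
  h_basis f_dual (apc_counit M_comod) m_span (lpi_quotient_map Q)) => z.
have Q_genE l t : Q_gen l t =
    tensor_counit (f t) (M ⊗ H) (coassoc_defect Delta dM (m l)).
  rewrite [RHS]linearB /Q_gen; congr (_ - _).
    by rewrite -(slice_coaction_twice f_dual b_finite dM_m).
  by rewrite -(slice_coaction_comul f_dual a_finite Delta_h b_finite dM_m).
split=> [[l [t ->]]|[_ [t [[l _ <-] ->]]]]; last by exists l, t.
by exists (m l), t; split; [exists l | exact: Q_genE].
Qed.
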